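(* Let $p=\big((x_1,y_1),(x_2,y_2)\big)$ be a pair of points of $(0,1)^2$ with $x_1<x_2$ and $y_2<y_1$, let $T=Z_p$ be the zipper map of parameter $p$, let $\lambda_{\min}=\min\big(\frac{y_1}{x_1},\frac{y_1-y_2}{x_2-x_1},\frac{1-y_2}{1-x_2}\big)$ and $h_{\min}=\min(x_1,x_2-x_1,1-x_2)<1$. Assume that $T$ is hypersensitive, i.e. $\lambda_{\min}>1$. Then the metric mean dimension of $T$ relative to the Euclidean metric $|\cdot|$ on $[0,1]$ satisfies \[\operatorname{mdim}_M(T,|\cdot|)\ \ge\ \frac{\log\lambda_{\min}}{|\log h_{\min}|}>0.\]
   Context: Zipper maps. Let $\mathscr{C}^0_0$ be the set of continuous maps $f:[0,1]\to[0,1]$ with $f(0)=0$ and $f(1)=1$, with the uniform distance. For $p=\big((x_1,y_1),(x_2,y_2)\big)$ with both points in $(0,1)^2$, $x_1<x_2$, $y_2<y_1$, let $\Phi_p:\mathscr{C}^0_0\to\mathscr{C}^0_0$ be defined by: $\Phi_pf(x)=y_1 f\big(\frac{x}{x_1}\big)$ if $x\in[0,x_1]$; $\Phi_pf(x)=y_1-(y_1-y_2)f\big(\frac{x-x_1}{x_2-x_1}\big)$ if $x\in[x_1,x_2]$; $\Phi_pf(x)=y_2+(1-y_2)f\big(\frac{x-x_2}{1-x_2}\big)$ if $x\in[x_2,1]$. The map $\Phi_p$ is a contraction in the uniform norm; the zipper map $Z_p\in\mathscr{C}^0_0$ of parameter $p$ is its unique fixed point. Metric mean dimension. Let $T:\Omega\to\Omega$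 be a continuous map of a compact space with metric $d$. Set $d_n(x,y)=\max\{d(T^k(x),T^k(y))\mid 0\le k<n\}$. A set $S\subset\Omega$ is $(n,\varepsilon)$-separated when $d_n(x,y)\ge\varepsilon$ for all $x\ne y$ in $S$; $N(d,T,\varepsilon,n)$ is the largest cardinality of an $(n,\varepsilon)$-separated set. The metric mean dimension of $T$ relative to $d$ is \[\operatorname{mdim}_M(T,d)=\liminf_{\varepsilon\to0}\limsup_{n\to\infty}\frac{\log N(d,T,\varepsilon,n)}{n\log\frac1\varepsilon}.\] *)

(* Defs.v *)
From HB Require Import structures.
From mathcomp Require Import all_boot all_order all_algebra finmap.
From mathcomp Require Import all_classical all_reals all_analysis.
From mathcomp Require Import ring lra.

Set Implicit Arguments.
Unset Strict Implicit.
Unset Printing Implicit Defensive.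

Import Order.TTheory GRing.Theory Num.Theory.
Import numFieldNormedType.Exports.

Local Open Scope classical_set_scope.
Local Open Scope ring_scope.

Section ZipperMaps.
Variable R : realType.
Implicit Types (f : R -> R) (p : (R * R) * (R * R)).

(* Maps [0,1] -> [0,1] are represented by functions R -> R whose values off
   [0,1] are irrelevant. *)
Definition C00 : set (R -> R) := [set f : R -> R |
  [/\ {within `[0, 1], continuous f},
      forall x, x \in `[0, 1]%R -> f x \in `[0, 1]%R,
      f 0 = 0 & f 1 = 1]].

Definition zipper_param p : Prop :=
  let: ((x1, y1), (x2, y2)) := p in
  [/\ [/\ 0 < x1 < 1, 0 < y1 < 1, 0 < x2 < 1 & 0 < y2 < 1],
      x1 < x2 & y2 < y1].

Definition zipper_op p f : R -> R := fun x =>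
  let: ((x1, y1), (x2, y2)) := p in
  if x <= x1 then y1 * f (x / x1)
  else if x <= x2 then y1 - (y1 - y2) * f ((x - x1) / (x2 - x1))
  else y2 + (1 - y2) * f ((x - x2) / (1 - x2)).

Definition zipper_fixpoint p : set (R -> R) := [set f : R -> R |
  C00 f /\ {in `[0, 1]%R, zipper_op p f =1 f}].

(* The choice made by [get] is immaterial on [0,1]: see [zipper_mapP] and
   [zipper_map_unique]. *)
Definition zipper_map p : R -> R := get (zipper_fixpoint p).

Definition lambda_min p : R :=
  let: ((x1, y1), (x2, y2)) := p in
  Num.min (y1 / x1)
    (Num.min ((y1 - y2) / (x2 - x1)) ((1 - y2) / (1 - x2))).

Definition h_min p : R :=
  let: ((x1, y1), (x2, y2)) := p in
  Num.min x1 (Num.min (x2 - x1) (1 - x2)).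

End ZipperMaps.

Section ZipperWellDefined.
Variables (R : realType) (x1 y1 x2 y2 : R).
Let p := ((x1, y1), (x2, y2)).
Hypothesis hp : zipper_param p.

Let clamp (x : R) : R := Num.max 0 (Num.min 1 x).

Let clampE x : [\/ x <= 0 /\ clamp x = 0, 0 <= x <= 1 /\ clamp x = x
  | 1 <= x /\ clamp x = 1].
Proof.
rewrite /clamp; have [x1'|x1'] := leP 1 x.
  by apply: Or33; split => //; rewrite max_r.
have [x0|x0] := leP 0 x; first by apply: Or32; rewrite ltW.
by apply: Or31; rewrite ltW.
Qed.

Let clamp_id x : 0 <= x <= 1 -> clamp x = x.
Proof. by move=> /andP[a b]; rewrite /clamp min_r// max_r. Qed.

Let clamp_lo x : x <= 0 -> clamp x = 0.
Proof. by move=> x0; case: (clampE x) => -[] ? ->//; lra. Qed.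

Let clamp_hi x : 1 <= x -> clamp x = 1.
Proof. by move=> x0; case: (clampE x) => -[] ? ->//; lra. Qed.

Let clamp01 x : 0 <= clamp x <= 1.
Proof. by case: (clampE x) => -[] ? ->; lra. Qed.

Let continuous_clamp : continuous clamp.
Proof.
have cstc (a : R) (x : R) : {for x, continuous (fun=> a : R^o)}.
  exact: cst_continuous.
move=> x; have := @continuous_max R R (fun=> 0) (fun x => Num.min 1 x) x.
apply; first exact: cstc.
have := @continuous_min R R (fun=> 1) id x.
by apply; [exact: cstc|exact: cvg_id].
Qed.

(* [zipper_op p f] on [0,1], written without case distinction *)
Let Psi (f : R -> R) x : R :=
  y1 * f (clamp (x / x1)) - (y1 - y2) * f (clamp ((x - x1) / (x2 - x1)))
  + (1 - y2) * f (clamp ((x - x2) / (1 - x2))).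

Let nice (f : R -> R) :=
  [/\ continuous f, forall x, 0 <= f x <= 1, f 0 = 0 & f 1 = 1].

Let c := Num.max y1 (Num.max (y1 - y2) (1 - y2)).

Let c01 : 0 < c < 1.
Proof.
case: hp => -[? ? ? ?] ? ?.
by rewrite /c !lt_max !gt_max; apply/andP; split; [apply/orP; left|]; lra.
Qed.

Let c1 : y1 <= c. Proof. by rewrite /c le_max lexx. Qed.
Let c2 : y1 - y2 <= c. Proof. by rewrite /c !le_max lexx orbT. Qed.
Let c3 : 1 - y2 <= c. Proof. by rewrite /c !le_max lexx !orbT. Qed.

Let cases (x : R) : [\/ [/\ x <= x1, clamp ((x - x1) / (x2 - x1)) = 0
      & clamp ((x - x2) / (1 - x2)) = 0],
    [/\ x1 < x, x <= x2, clamp (x / x1) = 1 & clamp ((x - x2) / (1 - x2)) = 0]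
  | [/\ x1 < x, x2 < x, clamp (x / x1) = 1
      & clamp ((x - x1) / (x2 - x1)) = 1]].
Proof.
case: hp => -[? ? ? ?] ? ?.
case: (lerP x x1) => xx1.
  by apply: Or31; split => //; apply: clamp_lo;
    rewrite ler_pdivrMr ?mul0r; lra.
case: (lerP x x2) => xx2.
  apply: Or32; split => //; first by apply: clamp_hi; rewrite ler_pdivlMr; lra.
  by apply: clamp_lo; rewrite ler_pdivrMr ?mul0r; lra.
by apply: Or33; split => //; apply: clamp_hi; rewrite ler_pdivlMr; lra.
Qed.

Let zipper_op_Psi f x : f 0 = 0 -> f 1 = 1 -> 0 <= x <= 1 ->
  zipper_op p f x = Psi f x.
Proof.
case: hp => -[? ? ? ?] ? ? f0 f1 x01; rewrite /zipper_op /p /Psi.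
case: (cases x) => [[xx1 -> ->]|[xx1 xx2 -> ->]|[xx1 xx2 -> ->]].
- rewrite xx1 f0 clamp_id; first lra.
  by apply/andP; split; [apply: divr_ge0|rewrite ler_pdivrMr]; lra.
- rewrite leNgt xx1 xx2 /= f0 f1 clamp_id; first lra.
  by apply/andP; split; [apply: divr_ge0|rewrite ler_pdivrMr]; lra.
- rewrite !leNgt xx1 xx2 /= f1 clamp_id; first lra.
  by apply/andP; split; [apply: divr_ge0|rewrite ler_pdivrMr]; lra.
Qed.

Let Psi_contract (f g : R -> R) (e : R) : f 0 = 0 -> f 1 = 1 ->
  g 0 = 0 -> g 1 = 1 ->
  (forall x, 0 <= x <= 1 -> `|f x - g x| <= e) ->
  forall x, `|Psi f x - Psi g x| <= c * e.
Proof.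
case: hp => -[? ? ? ?] ? ? f0 f1 g0 g1 fg x; rewrite /Psi.
have key k t : 0 <= k <= c -> `|k * (f (clamp t) - g (clamp t))| <= c * e.
  move=> /andP[k0 kc]; rewrite normrM (ger0_norm k0).
  by rewrite ler_pM// fg// clamp01.
case: (cases x) => [[xx1 -> ->]|[xx1 xx2 -> ->]|[xx1 xx2 -> ->]].
- rewrite f0 g0; set u := clamp _.
  rewrite [X in `|X|](_ : _ = y1 * (f u - g u)); last by ring.
  by apply: key; have := c1; lra.
- rewrite f0 g0 f1 g1; set u := clamp _.
  rewrite [X in `|X|](_ : _ = - ((y1 - y2) * (f u - g u))); last by ring.
  by rewrite normrN; apply: key; have := c2; lra.
- rewrite f1 g1; set u := clamp _.
  rewrite [X in `|X|](_ : _ = (1 - y2) * (f u - g u)); last by ring.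
  by apply: key; have := c3; lra.
Qed.

Let Psi_nice f : nice f -> nice (Psi f).
Proof.
case: hp => -[? ? ? ?] ? ? [fc f01 f0 f1]; split.
- have inner (h : R -> R) x : h t @[t --> x] --> h x ->
      f (clamp (h t)) @[t --> x] --> f (clamp (h x)).
    move=> hc; apply: (@continuous_comp _ _ _ h (f \o clamp)) => //.
    by apply: continuous_comp; [exact: continuous_clamp|exact: fc].
  have div (h : R -> R) (b x : R) : h t @[t --> x] --> h x ->
      (h t / b) @[t --> x] --> h x / b.
    by move=> hc; apply: cvgM => //; exact: cvg_cst.
  have sub (a x : R) : (t - a) @[t --> x] --> x - a.
    by apply: cvgB; [exact: cvg_id|exact: cvg_cst].
  move=> x; rewrite /Psi; apply: cvgD; [apply: cvgB|];
    (apply: cvgM; first exact: cvg_cst).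
  + by apply: (inner (fun t => t / x1)); apply: (div id); exact: cvg_id.
  + by apply: (inner (fun t => (t - x1) / (x2 - x1)));
      apply: (div (fun t => t - x1)).
  + by apply: (inner (fun t => (t - x2) / (1 - x2)));
      apply: (div (fun t => t - x2)).
- move=> x; rewrite /Psi.
  case: (cases x) => [[xx1 -> ->]|[xx1 xx2 -> ->]|[xx1 xx2 -> ->]];
    rewrite ?f0 ?f1; set u := clamp _; have := f01 u; nra.
- rewrite /Psi !clamp_lo ?f0; first by lra.
  + by rewrite ler_pdivrMr; lra.
  + by rewrite ler_pdivrMr; lra.
  + by rewrite mul0r.
- rewrite /Psi !clamp_hi ?f1; first by lra.
  + by rewrite ler_pdivlMr; lra.
  + by rewrite ler_pdivlMr; lra.
  + by rewrite ler_pdivlMr; lra.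
Qed.

Let F n : R -> R := iter n Psi clamp.

Let F_nice n : nice (F n).
Proof.
elim: n => [|n ih]; last exact: Psi_nice.
split; [exact: continuous_clamp|exact: clamp01| |].
  exact: clamp_lo.
exact: clamp_hi.
Qed.

Let F_step n x : `|F n.+1 x - F n x| <= c ^+ n.
Proof.
elim: n x => [|n ih] x.
  have [_ + _ _] := F_nice 1; move=> /(_ x).
  have [_ + _ _] := F_nice 0; move=> /(_ x).
  by rewrite ler_norml expr0; lra.
have [_ _ ? ?] := F_nice n.+1; have [_ _ ? ?] := F_nice n.
by rewrite exprS; apply: Psi_contract => // z _; exact: ih.
Qed.

Let F_dist n m x : `|F (n + m)%N x - F n x| <= c ^+ n / (1 - c).
Proof.
have /andP[c_gt0 c_lt1] := c01.
suff : `|F (n + m)%N x - F n x| <= c ^+ n / (1 - c) * (1 - c ^+ m).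
  move/le_trans; apply; rewrite ler_piMr//.
    by rewrite divr_ge0 ?exprn_ge0//; lra.
  by rewrite lerBlDr lerDl exprn_ge0// ltW.
elim: m => [|m ih].
  by rewrite addn0 subrr normr0 expr0 subrr mulr0.
rewrite addnS.
have -> : F (n + m).+1 x - F n x =
  (F (n + m).+1 x - F (n + m)%N x) + (F (n + m)%N x - F n x) by ring.
apply: (le_trans (ler_normD _ _)).
apply: (le_trans (lerD (F_step _ _) ih)).
rewrite le_eqVlt; apply/orP; left; apply/eqP.
by rewrite exprD exprS; field; lra.
Qed.

Let cvg_bound : (fun n => c ^+ n / (1 - c)) @ \oo --> (0 : R).
Proof.
have /andP[c_gt0 c_lt1] := c01.
rewrite -[X in _ --> X](mul0r (1 - c)^-1); apply: cvgM; [|exact: cvg_cst].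
by apply: cvg_expr; rewrite gtr0_norm.
Qed.

Let cvg_F x : cvgn (F ^~ x).
Proof.
apply/cauchy_cvgP/cauchy_exP => e e0.
move/cvgrPdist_lt : cvg_bound => /(_ _ e0) [N _ HN].
exists (F N x); exists N => // n /= Nn; rewrite /ball/= distrC -(subnKC Nn).
apply: (le_lt_trans (F_dist _ _ _)).
have := HN N (leqnn N); rewrite /= sub0r normrN.
by apply: le_lt_trans; rewrite ler_norm.
Qed.

Let Z x : R := limn (F ^~ x).

Let Z_dist n x : `|Z x - F n x| <= c ^+ n / (1 - c).
Proof.
have h : (fun m => `|F m x - F n x|) @ \oo --> `|Z x - F n x|.
  by apply: cvg_norm; apply: cvgB; [exact: cvg_F|exact: cvg_cst].
rewrite -(cvg_lim _ h)//; apply: limr_le; first by apply: cvgP h.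
exists n => // m /= nm; rewrite -(subnKC nm); exact: F_dist.
Qed.

Let Z_cont : continuous Z.
Proof.
move=> x; apply/cvgrPdist_lt => e e0.
have e30 : 0 < e / 3 by lra.
move/cvgrPdist_lt : cvg_bound => /(_ _ e30) [N _ HN].
have {}HN : c ^+ N / (1 - c) < e / 3.
  have := HN N (leqnn N); rewrite /= sub0r normrN.
  by apply: le_lt_trans; rewrite ler_norm.
have [Fc _ _ _] := F_nice N.
move/cvgrPdist_lt : (Fc x) => /(_ _ e30); apply: filterS => y hy.
have h1 := Z_dist N x; have h2 := Z_dist N y.
have -> : Z x - Z y = (Z x - F N x) + (F N x - F N y) - (Z y - F N y) by ring.
apply: (le_lt_trans (ler_normB _ _)).
have := ler_normD (Z x - F N x) (F N x - F N y); lra.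
Qed.

Let Z_nice : nice Z.
Proof.
split; first exact: Z_cont.
- move=> x; apply/andP; split.
    apply: limr_ge; first exact: cvg_F.
    by apply: nearW => n; have [_ /(_ x) /andP[]] := F_nice n.
  apply: limr_le; first exact: cvg_F.
  by apply: nearW => n; have [_ /(_ x) /andP[]] := F_nice n.
- rewrite /Z (_ : F ^~ 0 = cst 0) ?lim_cst//.
  by apply/funext => n; have [] := F_nice n.
- rewrite /Z (_ : F ^~ 1 = cst 1) ?lim_cst//.
  by apply/funext => n; have [] := F_nice n.
Qed.

Let Z_fix x : Psi Z x = Z x.
Proof.
have h1 : (fun n => F n.+1 x) @ \oo --> Z x.
  by rewrite (cvg_shiftS (F ^~ x)); apply: cvg_F.
have h2 : (fun n => F n.+1 x) @ \oo --> Psi Z x.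
  rewrite /F /= -/F /Psi; apply: cvgD; [apply: cvgB|];
    by apply: cvgM; [exact: cvg_cst|exact: cvg_F].
exact: (cvg_unique _ h2 h1).
Qed.

Lemma zipper_mapP_aux : zipper_fixpoint p (zipper_map p).
Proof.
apply: (@getI _ _ Z); have [Zc Z01 Z0 Z1] := Z_nice.
split; first split => //.
- exact: continuous_subspaceT.
- by move=> x _; rewrite in_itv/=.
- by move=> x x01; rewrite zipper_op_Psi//; move: x01; rewrite in_itv.
Qed.

Lemma zipper_fixpoint_unique_aux f g :
  zipper_fixpoint p f -> zipper_fixpoint p g -> {in `[0, 1]%R, f =1 g}.
Proof.
move=> [[_ f01 f0 f1] fE] [[_ g01 g0 g1] gE].
have H n x : 0 <= x <= 1 -> `|f x - g x| <= c ^+ n.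
  elim: n x => [|n ih] x x01.
    have xI : x \in `[0, 1]%R by rewrite in_itv.
    have := f01 x xI; have := g01 x xI; rewrite !in_itv/=.
    by rewrite ler_norml expr0; lra.
  rewrite -fE ?in_itv// -gE ?in_itv// !zipper_op_Psi//.
  by rewrite exprS; apply: Psi_contract.
move=> x; rewrite in_itv/= => x01; apply/eqP; rewrite -subr_eq0 -normr_le0.
have /andP[c_gt0 c_lt1] := c01.
have cc : GRing.exp c @ \oo --> (0 : R) by apply: cvg_expr; rewrite gtr0_norm.
rewrite -(cvg_lim _ cc)//; apply: limr_ge; first exact: cvgP cc.
by apply: nearW => n; exact: H.
Qed.

End ZipperWellDefined.

Lemma zipper_mapP (R : realType) (p : (R * R) * (R * R)) :
  zipper_param p -> zipper_fixpoint p (zipper_map p).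
Proof. by case: p => -[x1 y1] [x2 y2]; exact: zipper_mapP_aux. Qed.

Lemma zipper_map_unique (R : realType) (p : (R * R) * (R * R)) (f : R -> R) :
  zipper_param p -> zipper_fixpoint p f -> {in `[0, 1]%R, f =1 zipper_map p}.
Proof.
case: p => -[x1 y1] [x2 y2] hp hf.
exact: (zipper_fixpoint_unique_aux hp hf (zipper_mapP hp)).
Qed.

Section MetricMeanDimension.
Variables (R : realType) (X : choiceType).
(* The system is T restricted to Omega, with the metric d on Omega. *)
Implicit Types (Omega : set X) (d : X -> X -> R) (T : X -> X).

Definition dyn_dist d T n (x y : X) : R :=
  \big[Num.max/0]_(k < n) d (iter k T x) (iter k T y).

Definition sep_set Omega d T n (e : R) (S : set X) : Prop :=
  S `<=` Omega /\
  forall x y, S x -> S y -> x <> y -> e <= dyn_dist d T n x y.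

Local Open Scope ereal_scope.

(* The largest cardinality, with value +oo if separated sets are not bounded
   in size; on a compact space it is finite and the supremum is attained. *)
Definition sep_number Omega d T (e : R) n : \bar R :=
  ereal_sup [set (#|` A|%:R)%:E | A in
    [set A : {fset X} | sep_set Omega d T n e [set` A]]].

Definition mdimM Omega d T : \bar R :=
  limf_einf (fun e : R => limn_esup (fun n : nat =>
    lne (sep_number Omega d T e n) * ((n%:R * ln e^-1)^-1)%:E)) 0^'+.

End MetricMeanDimension.

(* Main.v *)
(* Put alpha = ln lambda_min / |ln h_min|, so that 0 < alpha <= 1. A branch of
   width h <= 1 and height v satisfies h^(1 - alpha) <= v, and by self-similarity
   every interval of length s in [0,1] has an image of length at least
   C * s^(1 - alpha), for a constant C. Let L = C * e^(1 - alpha). An interval of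
   length L contains about L / (2e) = C * e^(-alpha) / 2 intervals of length e
   with gaps e, and the image of each of them again has length at least L. This
   horseshoe yields K^n points that are (n, e)-separated, with
   K ~ C * e^(-alpha) / 2, and ln K / ln (1/e) tends to alpha. *)
Require Import Defs.
From mathcomp Require Import all_boot all_order all_algebra finmap.
From mathcomp Require Import all_classical all_reals all_analysis.
From mathcomp Require Import ring lra.

Set Implicit Arguments.
Unset Strict Implicit.
Unset Printing Implicit Defensive.

Import Order.TTheory GRing.Theory Num.Theory.
Import numFieldNormedType.Exports.

Local Open Scope classical_set_scope.
Local Open Scope ring_scope.

(** * Dynamical distance and stretched intervals *)

Lemma dyn_distS (R : realType) (X : choiceType) (d : X -> X -> R) (T : X -> X)
    (m : nat) (x y : X) :
  dyn_dist d T m.+1 x y = Num.max (d x y) (dyn_dist d T m (T x) (T y)).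
Proof.
rewrite /dyn_dist big_ord_recl /=; congr (Num.max _ _).
by apply: eq_bigr => k _; rewrite -!iterSr.
Qed.

Lemma dyn_distxx (R : realType) (X : choiceType) (d : X -> X -> R) (T : X -> X)
    (m : nat) (x : X) : (forall y, d y y = 0) -> dyn_dist d T m x x = 0.
Proof.
move=> d0; elim: m x => [|m IHm] x; first by rewrite /dyn_dist big_ord0.
by rewrite dyn_distS IHm d0 maxxx.
Qed.

(** The increase is signed but [x] and [y] are not ordered, so for continuous [T] this says that the
    image of [a, b] has length at least [k]. *)
Definition stretches (R : realType) (T : R -> R) (a b k : R) : Prop :=
  exists x y, [/\ a <= x <= b, a <= y <= b & k <= T y - T x].

(** * Horseshoes and separated sets *)

Section Horseshoe.
Variables (R : realType) (T : R -> R) (e L : R) (K : nat).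
Let d (x y : R) : R := `|x - y|.
Hypothesis T_cont : {within `[0, 1], continuous T}.
Hypothesis T01 : forall x, x \in `[0, 1]%R -> T x \in `[0, 1]%R.
Hypothesis e_gt0 : 0 < e.
Hypothesis KeL : 2 * K%:R * e <= L.
Hypothesis T_stretch : forall a, 0 <= a -> a + e <= 1 ->
  stretches T a (a + e) L.

(** Words code itineraries. The tail of a word is realised inside the image of the interval chosen
    by its head, then pulled back through [T]. Words with different heads are separated at time 0,
    the others at a later time by induction. *)
Lemma horseshoe_family (m : nat) (u v : R) : 0 <= u -> u + L <= v -> v <= 1 ->
  exists f : m.-tuple 'I_K -> R, (forall t, u <= f t <= v) /\
    forall s t, s != t -> e <= dyn_dist d T m (f s) (f t).
Proof.
elim: m u v => [|m IHm] u v u0 uLv v1.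
  have L0 : 0 <= L.
    by apply: le_trans KeL; rewrite !mulr_ge0// ltW.
  exists (fun=> u); split => [t|s t]; first by rewrite lexx /=; lra.
  by rewrite (tuple0 s) (tuple0 t) eqxx.
(* The next time step starts in one of K intervals of length e, separated by
   gaps of length e; the image of each has length at least L. *)
pose a (k : 'I_K) := u + 2 * k%:R * e.
have a_ge k : u <= a k by rewrite lerDl !mulr_ge0// ltW.
(* As k <= K - 1, the last interval ends at most at u + (2K - 1) e, which is below u + L. *)
have a_le k : a k + e <= v.
  have : k%:R + 1 <= K%:R :> R by rewrite natr1 ler_nat ltn_ord.
  move/(ler_wpM2r (ltW e_gt0)); rewrite /a; move: KeL uLv e_gt0; lra.
have base k : exists f : m.-tuple 'I_K -> R,
    (forall t, exists2 z, a k <= z <= a k + e & T z = f t) /\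
    forall s t, s != t -> e <= dyn_dist d T m (f s) (f t).
  have ak0 := a_ge k; have ak1 := a_le k.
  have [||x [y [xI yI xyL]]] := @T_stretch (a k); [lra..|].
  have xT : T x \in `[0, 1]%R by apply: T01; rewrite in_itv/=; lra.
  have yT : T y \in `[0, 1]%R by apply: T01; rewrite in_itv/=; lra.
  rewrite !in_itv/= in xT yT.
  have [|||f [fI fsep]] := @IHm (T x) (T y); [lra..|].
  exists f; split => // t; have ft := fI t.
  have ivt b c : b <= c -> 0 <= b -> c <= 1 ->
      Num.min (T b) (T c) <= f t <= Num.max (T b) (T c) ->
      exists2 z, b <= z <= c & T z = f t.
    move=> bc b0 c1 ftI.
    have [|z] := IVT bc _ ftI; last by rewrite in_itv/=; exists z.
    apply: continuous_subspaceW T_cont => w /=; rewrite !in_itv/=; lra.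
  have [xy|yx] := leP x y.
    have [||||z ? ?] := ivt x y; [lra..| |exists z => //; lra].
    by rewrite ge_min le_max; case/andP: ft => -> ->; rewrite orbT.
  have [||||z ? ?] := ivt y x; [lra..| |exists z => //; lra].
  by rewrite ge_min le_max; case/andP: ft => -> ->; rewrite orbT.
have [f fP] := choice base.
have lift (w : m.+1.-tuple 'I_K) : exists z,
    a (thead w) <= z <= a (thead w) + e /\ T z = f (thead w) (behead_tuple w).
  by have [/(_ (behead_tuple w))[z ? ?] _] := fP (thead w); exists z.
have [g gP] := choice lift.
have gap (s t : m.+1.-tuple 'I_K) : (thead s < thead t)%N ->
    e <= d (g s) (g t).
  move=> st; have [sI _] := gP s; have [tI _] := gP t.
  have : (thead s)%:R + 1 <= (thead t)%:R :> R by rewrite natr1 ler_nat.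
  move/(ler_wpM2r (ltW e_gt0)); rewrite /d distrC ler_normr.
  by move: sI tI e_gt0; rewrite /a => sI tI e0 st'; apply/orP; left; lra.
exists g; split => [t|s t st].
  by have [tI _] := gP t; have := a_ge (thead t); have := a_le (thead t); lra.
rewrite dyn_distS le_max.
have [hst|hts|hE] := ltngtP (thead s) (thead t).
- by rewrite gap.
- by rewrite /d distrC gap.
apply/orP; right; move/val_inj : hE => hE.
have [_ ->] := gP s; have [_ ->] := gP t; rewrite -hE.
have [_ ->//] := fP (thead s); apply: contra_neq st => bE.
apply: val_inj; rewrite (tuple_eta s) (tuple_eta t) hE /=.
by have := congr1 val bE => /= ->.
Qed.

(** Since e > 0, separation makes the coding injective, so the K^m words give K^m distinct
    points. *)
Lemma sep_number_horseshoe (m : nat) : L <= 1 ->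
  ((K%:R ^+ m)%:E <= sep_number `[0%R, 1%R] d T e m)%E.
Proof.
move=> L1; have [|f [f01 fsep]] := @horseshoe_family m 0 1 (lexx 0) _ (lexx 1).
  by rewrite add0r.
have f_inj : injective f.
  move=> s t st; apply/eqP; apply: contraT => /fsep.
  rewrite st dyn_distxx ?leNgt ?e_gt0// => y.
  by rewrite /d subrr normr0.
apply: ereal_sup_ubound => /=.
exists [fset f t | t : m.-tuple 'I_K]%fset; last first.
  by rewrite card_imfset//= -cardE card_tuple card_ord natrX.
split => [x /= /imfsetP[t _ ->]|x y /= /imfsetP[s _ ->] /imfsetP[t _ ->] st].
  by rewrite in_itv/= f01.
by apply: fsep; apply: contra_notN st => /eqP ->.
Qed.

End Horseshoe.

(** * Stretching by a self-affine map, with [beta] in the role of 1 - alpha *)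

Section Stretching.
Variables (R : realType) (T : R -> R) (x1 y1 x2 y2 beta : R).
Hypothesis hp : zipper_param ((x1, y1), (x2, y2)).
Hypothesis beta01 : 0 <= beta <= 1.

Lemma stretches_weaken a b k a' b' k' : a <= a' -> b' <= b -> k <= k' ->
  stretches T a' b' k' -> stretches T a b k.
Proof. by move=> aa bb kk [x [y [? ? ?]]]; exists x, y; split; lra. Qed.

(** Induction on scale: each appeal to the hypothesis lengthens the interval by a factor at least 1
    / H > 1, which can happen only finitely often inside [0, 1]. *)
Lemma expanding_interval_ind (H : R) (P : R -> R -> Prop) : 0 < H < 1 ->
  (forall a b, 0 <= a -> a < b -> b <= 1 ->
    (forall a' b', 0 <= a' -> a' < b' -> b' <= 1 ->
      b - a <= H * (b' - a') -> P a' b') -> P a b) ->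
  forall a b, 0 <= a -> a < b -> b <= 1 -> P a b.
Proof.
move=> /andP[H0 H1] Pstep.
have short n a b : 0 <= a -> a < b -> b <= 1 -> H ^+ n < b - a -> P a b.
  elim: n a b => [|n IHn] a b a0 ab b1; first by rewrite expr0; lra.
  move=> Hnab; apply: Pstep => // a' b' a0' ab' b1' Hba; apply: IHn => //.
  rewrite -(ltr_pM2l H0) -exprS; exact: lt_le_trans Hba.
move=> a b a0 ab b1.
have HX : GRing.exp H @ \oo --> (0 : R) by apply: cvg_expr; rewrite gtr0_norm.
have ba0 : 0 < b - a by lra.
have /cvgrPdist_lt/(_ _ ba0)[n _ /(_ n (leqnn n))] := HX.
rewrite /= sub0r normrN ger0_norm ?exprn_ge0 1?ltW//; exact: short.
Qed.

(** As beta <= 1, (1/2)^beta >= 1/2: halving an interval costs at most a factor 2. *)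
Lemma powR_half_ge (s t : R) : 0 <= s -> s / 2 <= t ->
  s `^ beta / 2 <= t `^ beta.
Proof.
case/andP: beta01 => b0 b1 s0 st; apply: (@le_trans _ _ ((s / 2) `^ beta)).
  rewrite powRM// ler_wpM2l ?powR_ge0//.
  by apply: ger1_powR => //; lra.
by apply: ge0_ler_powR; rewrite ?nnegrE//; lra.
Qed.

Lemma powR_le1 (s : R) : 0 <= s <= 1 -> s `^ beta <= 1.
Proof.
case/andP: beta01 => b0 b1 /andP[s0 s1].
by have := ge0_ler_powR b0 s0 ler01 s1; rewrite powR1.
Qed.

(** Undoing the rescaling multiplies the required stretch by h^beta and the actual one by |w| >=
    h^beta, so [C] is preserved. This allows unboundedly many rescalings. *)
Lemma affine_branch_stretches (l h A w C a b : R) : 0 < h -> 0 <= C ->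
  h `^ beta <= `|w| ->
  (forall u, 0 <= u <= 1 -> T (l + h * u) = A + w * T u) ->
  l <= a -> a < b -> b <= l + h ->
  stretches T ((a - l) / h) ((b - l) / h)
    (C * ((b - l) / h - (a - l) / h) `^ beta) ->
  stretches T a b (C * (b - a) `^ beta).
Proof.
move=> h0 C0 hw Tlh la ab blh; rewrite -mulrBl.
have -> : b - l - (a - l) = b - a by ring.
set s := (b - a) / h; move=> [x [y []]].
have inv z : (a - l) / h <= z <= (b - l) / h ->
    [/\ 0 <= z, z <= 1 & a <= l + h * z <= b].
  rewrite ler_pdivrMr// ler_pdivlMr// => /andP[az zb].
  by split; [rewrite -(pmulr_lge0 z h0)|rewrite -(ler_pM2r h0)|]; lra.
move=> /inv[x0 x1' xI] /inv[y0 y1' yI] xyC.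
have -> : b - a = h * s by rewrite /s; field; lra.
have s0 : 0 <= s by apply: divr_ge0; lra.
have key : C * (h * s) `^ beta <= `|w| * (T y - T x).
  rewrite (powRM _ (ltW h0) s0) mulrCA; apply: ler_pM => //; first exact: powR_ge0.
  by rewrite mulr_ge0// powR_ge0.
have xT : T (l + h * x) = A + w * T x by apply: Tlh; rewrite x0.
have yT : T (l + h * y) = A + w * T y by apply: Tlh; rewrite y0.
(* A decreasing branch exchanges the roles of the two points. *)
have [w0|w0] := leP 0 w.
  exists (l + h * x), (l + h * y); split => //; rewrite xT yT.
  by move: key; rewrite ger0_norm//; lra.
exists (l + h * y), (l + h * x); split => //; rewrite xT yT.
by move: key; rewrite ltr0_norm//; lra.
Qed.

Hypothesis T0 : T 0 = 0.
Hypothesis T1 : T 1 = 1.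
Hypothesis Tbranch1 : forall u, 0 <= u <= 1 -> T (0 + x1 * u) = 0 + y1 * T u.
Hypothesis Tbranch2 : forall u, 0 <= u <= 1 ->
  T (x1 + (x2 - x1) * u) = y1 + - (y1 - y2) * T u.
Hypothesis Tbranch3 : forall u, 0 <= u <= 1 ->
  T (x2 + (1 - x2) * u) = y2 + (1 - y2) * T u.
Hypothesis slope1 : x1 `^ beta <= y1.
Hypothesis slope2 : (x2 - x1) `^ beta <= y1 - y2.
Hypothesis slope3 : (1 - x2) `^ beta <= 1 - y2.

(** The largest branch width: rescaling a branch to [0, 1] lengthens its subintervals by at least 1
    / H. *)
Let H := Num.max x1 (Num.max (x2 - x1) (1 - x2)).
(** An interval that covers an outer branch is stretched at least this much. *)
Let C0 := Num.min y1 (1 - y2).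

Let Tx1 : T x1 = y1.
Proof. by have := @Tbranch1 1; rewrite add0r mulr1 T1 mulr1 add0r => ->; lra. Qed.

Let Tx2 : T x2 = y2.
Proof. by have := @Tbranch3 0; rewrite !mulr0 addr0 T0 mulr0 addr0 => ->; lra. Qed.

Let H01 : 0 < H < 1.
Proof.
case: hp => -[? ? ? ?] ? ?.
by rewrite /H lt_max !gt_max; apply/andP; split; lra.
Qed.

Let C0_gt0 : 0 < C0.
Proof. by case: hp => -[? ? ? ?] ? ?; rewrite /C0 lt_min; lra. Qed.

Let branch_expands (P : R -> R -> Prop) l h a b : 0 < h <= H ->
  l <= a -> a < b -> b <= l + h ->
  (forall a' b', 0 <= a' -> a' < b' -> b' <= 1 ->
    b - a <= H * (b' - a') -> P a' b') ->
  P ((a - l) / h) ((b - l) / h).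
Proof.
move=> /andP[h0 hH] la ab blh; apply.
- by apply: divr_ge0; lra.
- by rewrite ltr_pM2r ?invr_gt0//; lra.
- by rewrite ler_pdivrMr//; lra.
- rewrite -mulrBl; have -> : b - l - (a - l) = b - a by ring.
  by rewrite mulrA ler_pdivlMr// mulrC ler_wpM2r//; lra.
Qed.

Let x1H : 0 < x1 <= H.
Proof. by case: hp => -[/andP[-> _] ? ? ?] ? ?; rewrite /H le_max lexx. Qed.

Let x21H : 0 < x2 - x1 <= H.
Proof. by case: hp => ? ? ?; rewrite subr_gt0 /H !le_max lexx orbT andbT. Qed.

Let x2H : 0 < 1 - x2 <= H.
Proof.
by case: hp => -[? ? ? ?] ? ?; rewrite subr_gt0 /H !le_max lexx !orbT andbT; lra.
Qed.

Let branch1 C a b : 0 <= C -> 0 <= a -> a < b -> b <= x1 ->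
  stretches T ((a - 0) / x1) ((b - 0) / x1)
    (C * ((b - 0) / x1 - (a - 0) / x1) `^ beta) ->
  stretches T a b (C * (b - a) `^ beta).
Proof.
case: hp => -[? ? ? ?] ? ? C0' a0 ab bx.
apply: (affine_branch_stretches _ _ _ Tbranch1) => //; try lra.
by rewrite ger0_norm//; lra.
Qed.

Let branch2 C a b : 0 <= C -> x1 <= a -> a < b -> b <= x2 ->
  stretches T ((a - x1) / (x2 - x1)) ((b - x1) / (x2 - x1))
    (C * ((b - x1) / (x2 - x1) - (a - x1) / (x2 - x1)) `^ beta) ->
  stretches T a b (C * (b - a) `^ beta).
Proof.
case: hp => -[? ? ? ?] ? ? C0' a0 ab bx.
apply: (affine_branch_stretches _ _ _ Tbranch2) => //; try lra.
by rewrite normrN ger0_norm//; lra.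
Qed.

Let branch3 C a b : 0 <= C -> x2 <= a -> a < b -> b <= 1 ->
  stretches T ((a - x2) / (1 - x2)) ((b - x2) / (1 - x2))
    (C * ((b - x2) / (1 - x2) - (a - x2) / (1 - x2)) `^ beta) ->
  stretches T a b (C * (b - a) `^ beta).
Proof.
case: hp => -[? ? ? ?] ? ? C0' a0 ab bx.
apply: (affine_branch_stretches _ _ _ Tbranch3) => //; try lra.
by rewrite ger0_norm//; lra.
Qed.

(* An interval touching 0 or 1 keeps touching it under the rescaling by an outer
   branch, until it covers that branch. *)
Lemma edge_stretches a b : 0 <= a -> a < b -> b <= 1 -> a = 0 \/ b = 1 ->
  stretches T a b (C0 * (b - a) `^ beta).
Proof.
have C0ge := ltW C0_gt0.
pose P a b := a = 0 \/ b = 1 -> stretches T a b (C0 * (b - a) `^ beta).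
have big a' b' k : 0 <= a' -> a' < b' -> b' <= 1 -> C0 <= k ->
    stretches T a' b' k -> stretches T a' b' (C0 * (b' - a') `^ beta).
  move=> a0 ab b1 Ck; apply: stretches_weaken => //; apply: le_trans Ck.
  by rewrite ler_piMr// powR_le1//; lra.
case: hp => -[hx1 hy1 hx2 hy2] hx hy.
move: a b; apply: (expanding_interval_ind (P := P) H01) => a b a0 ab b1 IH.
case=> [aE|bE].
  have [bx1|x1b] := leP b x1.
    have bx1' : b <= 0 + x1 by rewrite add0r.
    apply: branch1 => //; apply: (branch_expands x1H _ _ bx1' IH) => //.
    by left; rewrite aE subrr mul0r.
  apply: (big _ _ y1) => //; first by rewrite /C0 ge_min lexx.
  by exists 0, x1; split; rewrite ?Tx1 ?T0; lra.
have [x2a|ax2] := leP x2 a.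
  have bx2' : b <= x2 + (1 - x2) by lra.
  apply: branch3 => //; apply: (branch_expands x2H _ _ bx2' IH) => //.
  by right; rewrite bE divff//; lra.
apply: (big _ _ (1 - y2)) => //; first by rewrite /C0 ge_min lexx orbT.
by exists x2, 1; split; rewrite ?Tx2 ?T1; lra.
Qed.

Let edge_rescaled l h a b : 0 < h -> l <= a -> a < b -> b <= l + h ->
  a = l \/ b = l + h ->
  stretches T ((a - l) / h) ((b - l) / h)
    (C0 * ((b - l) / h - (a - l) / h) `^ beta).
Proof.
move=> h0 la ab blh abE; apply: edge_stretches.
- by apply: divr_ge0; lra.
- by rewrite ltr_pM2r ?invr_gt0//; lra.
- by rewrite ler_pdivrMr//; lra.
- case: abE => ->; [left; by rewrite subrr mul0r|right].
  by rewrite addrAC subrr add0r divff//; lra.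
Qed.

(** The longer of the two pieces has at least half the length, whence the constant C0 / 2. *)
Let pivot a z b : a < z -> z < b ->
  stretches T a z (C0 * (z - a) `^ beta) ->
  stretches T z b (C0 * (b - z) `^ beta) ->
  stretches T a b (C0 / 2 * (b - a) `^ beta).
Proof.
move=> az zb Daz Dzb.
have half t : (b - a) / 2 <= t ->
    C0 / 2 * (b - a) `^ beta <= C0 * t `^ beta.
  move=> bat; rewrite mulrAC -mulrA ler_pM2l//.
  by apply: powR_half_ge => //; lra.
have [azb|zab] := leP ((b - a) / 2) (z - a).
  by apply: stretches_weaken Daz; [exact: lexx|lra|exact: half].
by apply: stretches_weaken Dzb; [lra|exact: lexx|apply: half; lra].
Qed.

(* If the interval meets several branches without covering one, it is cut at x1
   or x2, and its longer half is an edge interval of a branch. *)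
Lemma interval_stretches : exists2 C, 0 < C <= 1 &
  forall a b, 0 <= a -> a < b -> b <= 1 ->
    stretches T a b (C * (b - a) `^ beta).
Proof.
case: hp => -[hx1 hy1 hx2 hy2] hx hy.
(* C0 / 2 serves the intervals that are cut, y1 - y2 those that cover the middle branch. *)
pose C := Num.min (C0 / 2) (y1 - y2).
have Cgt0 : 0 < C by rewrite lt_min divr_gt0//; lra.
have C0ge := ltW C0_gt0; have Cge := ltW Cgt0.
exists C.
  by rewrite Cgt0 /C ge_min; apply/orP; right; lra.
apply: (expanding_interval_ind H01) => a b a0 ab b1 IH.
have viaC0 : stretches T a b (C0 / 2 * (b - a) `^ beta) ->
    stretches T a b (C * (b - a) `^ beta).
  apply: stretches_weaken => //.
  by rewrite ler_wpM2r ?powR_ge0// /C ge_min lexx.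
have [bx1|x1b] := leP b x1.
  have bx1' : b <= 0 + x1 by rewrite add0r.
  by apply: branch1 => //; apply: (branch_expands x1H _ _ bx1' IH).
have [x2a|ax2] := leP x2 a.
  have bx2' : b <= x2 + (1 - x2) by lra.
  by apply: branch3 => //; apply: (branch_expands x2H _ _ bx2' IH).
have [x1a|ax1] := leP x1 a; have [bx2|x2b] := leP b x2.
- have bx2' : b <= x1 + (x2 - x1) by lra.
  by apply: branch2 => //; apply: (branch_expands x21H _ _ bx2' IH).
- apply: viaC0; apply: (pivot ax2 x2b).
    by apply: branch2 => //; apply: edge_rescaled; try right; lra.
  by apply: branch3 => //; apply: edge_rescaled; try left; lra.
- apply: viaC0; apply: (pivot ax1 x1b).
    by apply: branch1 => //; apply: edge_rescaled; try right; lra.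
  by apply: branch2 => //; apply: edge_rescaled; try left; lra.
(* The middle branch decreases, so the larger value is taken at x1. *)
- exists x2, x1; split; rewrite ?Tx1 ?Tx2; [lra..|].
  apply: (@le_trans _ _ C); last by rewrite /C ge_min lexx orbT.
  by rewrite ler_piMr// powR_le1//; lra.
Qed.

End Stretching.

(** * From stretching to metric mean dimension *)

Lemma mdimM_ge_stretching (R : realType) (T : R -> R) (alpha C : R) :
  {within `[0, 1], continuous T} ->
  (forall x, x \in `[0, 1]%R -> T x \in `[0, 1]%R) ->
  0 < alpha <= 1 -> 0 < C <= 1 ->
  (forall a b, 0 <= a -> a < b -> b <= 1 ->
    stretches T a b (C * (b - a) `^ (1 - alpha))) ->
  (alpha%:E <= mdimM `[0%R, 1%R] (fun x y : R => `|x - y|%R) T)%E.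
Proof.
move=> Tc T01 /andP[al0 al1] /andP[C0 C1] Tstretch.
rewrite /mdimM limf_einfE; apply/lee_subgt0Pr => delta delta0.
rewrite -EFinB; set c := ln (C / 4).
(* The three bounds on ln e give, in turn: e < 1; that [delta] absorbs the constant, c - alpha ln e
   >= (alpha - delta) ln (1/e); and Q >= 4 below. *)
pose M := Num.min (-1) (Num.min (c / delta) (c / alpha)).
pose V := [set e : R | 0 < e /\ ln e <= M].
have VP : (0^'+ : set_system R) V.
  apply: filterI; first exact: nbhs_right_gt.
  by have /cvgrNyPle/(_ M) := @lnNy R.
(* The lower limit is a supremum of infima, so one neighbourhood [V] suffices; the upper limit is an
   infimum of suprema over tails, so one index per tail suffices. The index [N.+1] is nonzero, which
   keeps the division by n meaningful. *)
apply: le_ereal_sup_tmp; eexists; first by exists V.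
apply: le_ereal_inf_tmp => _ [e [e0 eM] <-].
apply: le_ereal_inf_tmp => _ [W [N _ NW] <-].
apply: le_ereal_sup_tmp.
eexists; first by exists N.+1; [apply: NW => /=|reflexivity].
move: eM; rewrite /M !le_min => /and3P[e1 ed ea].
rewrite ler_pdivlMr// in ed; rewrite ler_pdivlMr// in ea.
have C4 : 0 < C / 4 by lra.
have e_lt1 : e < 1 by rewrite -ltr_ln ?posrE// ln1; lra.
pose Q := C * e `^ (- alpha).
have Q0 : 0 < Q by rewrite mulr_gt0// powR_gt0.
have lnQ : ln (Q / 4) = c - alpha * ln e.
  by rewrite /Q mulrAC lnM ?posrE ?powR_gt0// ln_powR mulNr.
have Q4 : 4 <= Q.
  rewrite -[leLHS]mul1r -ler_pdivlMr// -ler_ln ?posrE ?ln1 ?lnQ; lra.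
pose K := Num.truncn (Q / 2).
have /andP[KQ QK] : K%:R <= Q / 2 < K.+1%:R by apply: truncn_itv; lra.
have QK4 : Q / 4 <= K%:R by move: QK; rewrite -[K.+1%:R]natr1; lra.
have K0 : 0 < K%:R :> R by lra.
have Ke : 2 * K%:R * e <= C * e `^ (1 - alpha).
  have -> : C * e `^ (1 - alpha) = Q * e.
    rewrite /Q powRD; last by rewrite (gt_eqF e0) implybT.
    by rewrite powRr1 1?ltW//; ring.
  by rewrite ler_pM2r//; lra.
have sepK := sep_number_horseshoe Tc T01 e0 Ke.
have {}sepK : ((K%:R ^+ N.+1)%:E <=
    sep_number `[0%R, 1%R] (fun x y : R => `|x - y|%R) T e N.+1)%E.
  apply: sepK => [a a0 ae|].
    have aae : a < a + e by lra.
    have [x [y [? ? h]]] := Tstretch _ _ a0 aae ae.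
    by exists x, y; split => //; move: h; rewrite addrAC subrr add0r.
  apply: mulr_ile1; [exact: ltW|exact: powR_ge0|exact: C1|].
  have b0 : 0 <= 1 - alpha by lra.
  by have := ge0_ler_powR b0 (ltW e0) ler01 (ltW e_lt1); rewrite powR1.
have KN : (0 < K%:R ^+ N.+1 :> R) by rewrite exprn_gt0.
have l0 : 0 < N.+1%:R * ln e^-1.
  by rewrite lnV ?posrE// mulr_gt0 ?ltr0n//; lra.
apply: (@le_trans _ _ (lne (K%:R ^+ N.+1)%:E *
    ((N.+1%:R * ln e^-1)^-1)%:E)%E); last first.
  apply: lee_wpmul2r; first by rewrite lee_fin invr_ge0 ltW.
  have KN' : (0 <= (K%:R ^+ N.+1)%:E :> \bar R)%E by rewrite lee_fin ltW.
  by rewrite lee_lne ?in_itv/= ?leey ?andbT// (le_trans KN').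
rewrite lne_EFin// -EFinM lee_fin lnXn// ler_pdivlMr//.
rewrite -[ln K%:R *+ _]mulr_natl mulrCA ler_pM2l ?ltr0n// lnV ?posrE//.
apply: (@le_trans _ _ (ln (Q / 4))); first by rewrite lnQ; lra.
by rewrite ler_ln ?posrE//; lra.
Qed.

(** * Application to zipper maps *)

(** With alpha the quotient of logarithms, h^(-alpha) = lam. As k >= h, k^(1 - alpha) = k k^(-alpha)
    <= k lam <= v. *)
Lemma powR_le_slope (R : realType) (lam h k v : R) : 1 < lam -> 0 < h < 1 ->
  h <= k -> lam <= v / k -> k `^ (1 - ln lam / `|ln h|) <= v.
Proof.
move=> lam1 /andP[h0 h1] hk lamvk.
have k0 : 0 < k by lra.
have lnh : ln h < 0 by rewrite ln_lt0// h0.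
have lamk : lam * k <= v by rewrite -ler_pdivlMr.
have lk0 : 0 < lam * k by rewrite mulr_gt0//; lra.
have lnhk : ln h <= ln k by rewrite ler_ln.
apply: le_trans lamk.
rewrite -ler_ln ?posrE ?powR_gt0// ln_powR lnM ?posrE//; last by lra.
rewrite ltr0_norm// mulrBl mul1r addrC lerD2r invrN mulrN mulNr opprK.
by rewrite mulrAC ler_ndivrMr// ler_pM2l// ln_gt0.
Qed.

Theorem theorem4 (R : realType) (p : (R * R) * (R * R))
    (hp : zipper_param p) (hyp : 1 < lambda_min p) :
  [/\ h_min p < 1,
      ((ln (lambda_min p) / `|ln (h_min p)|)%:E
         <= mdimM `[0%R, 1%R] (fun x y : R => `|x - y|%R) (zipper_map p))%E
    & 0 < ln (lambda_min p) / `|ln (h_min p)|].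
Proof.
have [[Tc T01 T0 T1] Tfix] := zipper_mapP hp.
move: p hp hyp Tc T01 T0 T1 Tfix => [[x1 y1] [x2 y2]] hp.
set T := zipper_map _; set lam := lambda_min _; set h := h_min _.
move=> lam1 Tc T01 T0 T1 Tfix.
have [[hx1 hy1 hx2 hy2] hx hy] := hp.
have [lam_1 lam_2 lam_3] : [/\ lam <= y1 / x1,
    lam <= (y1 - y2) / (x2 - x1) & lam <= (1 - y2) / (1 - x2)].
  by rewrite /lam /lambda_min !ge_min !lexx !orbT.
have [h_1 h_2 h_3] : [/\ h <= x1, h <= x2 - x1 & h <= 1 - x2].
  by rewrite /h /h_min !ge_min !lexx !orbT.
have h0 : 0 < h by rewrite /h /h_min !lt_min; lra.
have h1 : h < 1 by lra.
have lnh : ln h < 0 by rewrite ln_lt0// h0.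
have lnlam : 0 < ln lam by rewrite ln_gt0.
have al0 : 0 < ln lam / `|ln h| by rewrite divr_gt0// normr_gt0 lt_eqF.
(* Equivalent to lam <= 1 / h, which follows from lam h <= lam x1 <= y1 < 1. *)
have al1 : ln lam / `|ln h| <= 1.
  rewrite ltr0_norm// ler_pdivrMr ?oppr_gt0// mul1r -lnV ?posrE//.
  have lam0 : 0 < lam by lra.
  have x10 : 0 < x1 by lra.
  rewrite ler_ln ?posrE ?invr_gt0// -[leRHS]mul1r ler_pdivlMr//.
  rewrite ler_pdivlMr// in lam_1.
  have := ler_wpM2l (ltW lam0) h_1; lra.
split => //.
have fixE x : 0 <= x <= 1 -> zipper_op ((x1, y1), (x2, y2)) T x = T x.
  by move=> x01; apply: Tfix; rewrite in_itv.
have Tb1 u : 0 <= u <= 1 -> T (0 + x1 * u) = 0 + y1 * T u.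
  move=> u01; rewrite !add0r -fixE; last by nra.
  rewrite /zipper_op mulrC ler_piMl ?mulfK//; lra.
have Tb2 u : 0 <= u <= 1 ->
    T (x1 + (x2 - x1) * u) = y1 + - (y1 - y2) * T u.
  move=> u01; rewrite -fixE; last by nra.
  (* At u = 0 the point x1 falls under the first clause of [zipper_op]; the two clauses agree there
     because T 0 = 0 and T 1 = 1. The same happens at x2 for the third branch. *)
  have [->|u_neq0] := eqVneq u 0.
    by rewrite /zipper_op mulr0 addr0 lexx divff ?T1 ?T0; lra.
  have u0 : 0 < u by rewrite lt_neqAle eq_sym u_neq0; lra.
  rewrite /zipper_op ifF; last by apply/negbTE; rewrite -ltNge; nra.
  rewrite ifT; last by nra.
  have -> : (x1 + (x2 - x1) * u - x1) / (x2 - x1) = u by field; lra.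
  by rewrite mulNr.
have Tb3 u : 0 <= u <= 1 -> T (x2 + (1 - x2) * u) = y2 + (1 - y2) * T u.
  move=> u01; rewrite -fixE; last by nra.
  have [->|u_neq0] := eqVneq u 0.
    rewrite /zipper_op mulr0 addr0 lexx ifF; last first.
      by apply/negbTE; rewrite -ltNge.
    by rewrite divff ?T1 ?T0; lra.
  have u0 : 0 < u by rewrite lt_neqAle eq_sym u_neq0; lra.
  rewrite /zipper_op !ifF; [|by apply/negbTE; rewrite -ltNge; nra..].
  by have -> : (x2 + (1 - x2) * u - x2) / (1 - x2) = u by field; lra.
have beta01 : 0 <= 1 - ln lam / `|ln h| <= 1 by lra.
have h01 : 0 < h < 1 by rewrite h0.
have [C C01 CP] := interval_stretches hp beta01 T0 T1 Tb1 Tb2 Tb3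
  (powR_le_slope lam1 h01 h_1 lam_1) (powR_le_slope lam1 h01 h_2 lam_2)
  (powR_le_slope lam1 h01 h_3 lam_3).
by apply: (mdimM_ge_stretching Tc T01 _ C01 CP); rewrite al0.
Qed.
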